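(* Let $d\ge1$, let $S\subseteq\mathbb{Z}^d$ be finite and let $s_0\in S$ be an extreme point of $S$. Then for every $k\in\mathbb{N}$ there is a constant $\Lambda=\Lambda(d,S,k)$ such that every $k$-colouring of $\mathbb{Z}^d$ contains either an almost-monochromatic similar copy of $(S,s_0)$ (contained in $\mathbb{Z}^d$), or a monochromatic similar copy $f(\mathbb{Z}^d)\subseteq\mathbb{Z}^d$ of $\mathbb{Z}^d$ where $f$ is a similarity with integer scaling ratio $\lambda$ satisfying $1\le\lambda\le\Lambda$.
   Context: A $k$-colouring uses at most $k$ colours. $s_0$ is an extreme point of $S$ if $s_0\notin\operatorname{conv}(S\setminus\{s_0\})$. A similarity is a map $f(x)=\lambda Qx+c$ with $\lambda>0$ (its scaling ratio), $Q$ orthogonal, $c\in\mathbb{R}^d$; a similar copy of $(S,s_0)$ is $(f(S),f(s_0))$. A pair $(T,t_0)$ is almost-monochromatic if $T\setminus\{t_0\}$ is monochromatic but $T$ is not.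
   Formalization: S is assumed to have at least two points: for S={s_0} no copy of (S,s_0) is almost-monochromatic, and colouring Z^d by the sign of the first coordinate (k≥2) leaves no monochromatic similar copy of Z^d, so the claim fails. *)

(* Defs.v *)
From mathcomp Require Import all_boot all_order all_algebra.
From mathcomp Require Import finmap.
From mathcomp Require Import all_classical all_reals convex.

Set Implicit Arguments.
Unset Strict Implicit.
Unset Printing Implicit Defensive.

Import GRing.Theory Num.Theory.

Local Open Scope classical_set_scope.
Local Open Scope ring_scope.

(* Points of Z^d and R^d are column vectors; this is the inclusion of Z^d
   in R^d. *)
Definition intvec (R : realType) (d : nat) (x : 'cV[int]_d) : 'cV[R]_d :=
  map_mx intr x.
Arguments intvec R {d} x.

Definition conv (R : realType) (d : nat) (A : set 'cV[R]_d) : set 'cV[R]_d :=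
  smallest (@convex_set R 'cV[R]_d) A.

Definition extreme_point (R : realType) (d : nat)
    (A : set 'cV[R]_d) (a : 'cV[R]_d) : Prop :=
  A a /\ ~ conv (A `\ a) a.

Definition orthogonal_matrix (R : realType) (d : nat) (Q : 'M[R]_d) : Prop :=
  Q^T *m Q = 1%:M.

Definition similarity (R : realType) (d : nat) (lambda : R)
    (f : 'cV[R]_d -> 'cV[R]_d) : Prop :=
  0 < lambda /\
  exists (Q : 'M[R]_d) (c : 'cV[R]_d),
    orthogonal_matrix Q /\ forall x, f x = lambda *: (Q *m x) + c.

(* The subset T of Z^d is the image f(A); in particular f(A) is contained in
   Z^d. *)
Definition integral_image (R : realType) (d : nat)
    (f : 'cV[R]_d -> 'cV[R]_d) (A T : set 'cV[int]_d) : Prop :=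
  f @` (intvec R @` A) = intvec R @` T.

Definition similar_copy (R : realType) (d : nat)
    (S : set 'cV[int]_d) (s0 : 'cV[int]_d)
    (T : set 'cV[int]_d) (t0 : 'cV[int]_d) : Prop :=
  exists (lambda : R) (f : 'cV[R]_d -> 'cV[R]_d),
    [/\ similarity lambda f, integral_image f S T & f (intvec R s0) = intvec R t0].

(* The empty set and singletons are monochromatic, so a pair ([set t0], t0)
   is never almost-monochromatic. *)
Definition monochromatic (X C : Type) (chi : X -> C) (T : set X) : Prop :=
  forall x y, T x -> T y -> chi x = chi y.

Definition almost_monochromatic (X C : Type) (chi : X -> C)
    (T : set X) (t0 : X) : Prop :=
  monochromatic chi (T `\ t0) /\ ~ monochromatic chi T.

(* Main.v *)
(** By Gallai's theorem some ball p + n{x : |x|^2 <= N} is monochromatic, with n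
    bounded in terms of N and k only; we claim that, for a suitable N, the colour
    then spreads to all of p + nZ^d unless there is an almost-monochromatic copy.
    Since s0 is extreme, some v has positive inner product with s - s0 for all other
    s in S. A rational orthogonal matrix Q taking v close to the direction of -x makes
    every Q(s - s0) point towards the origin, so for |x| large the points
    x + D Q(s - s0), with D clearing denominators, are all closer to the origin than x.
    By induction on |x| they have the colour of the ball, hence so does x. Such a Q
    is plus or minus the reflection in an integer vector w of bounded size, and
    D = |w|^2. *)

Require Import Defs.
From mathcomp Require Import all_boot all_order all_algebra.
From mathcomp Require Import finmap.
From mathcomp Require Import all_classical all_reals.
From mathcomp Require Import convex interval_inference ring lra zify.

Set Implicit Arguments.
Unset Strict Implicit.
Unset Printing Implicit Defensive.

Import Order.TTheory GRing.Theory Num.Theory.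

Local Open Scope fset_scope.
Local Open Scope classical_set_scope.
Local Open Scope ring_scope.

(** * Gallai's theorem by colour focusing *)

Definition homothet_in (V : zmodType) (C : Type) (chi : V -> C) (F W : seq V)
    (L : nat) : Prop :=
  exists a n, [/\ (0 < n <= L)%N, (forall g, g \in F -> a + g *+ n \in W)
    & forall g h, g \in F -> h \in F -> chi (a + g *+ n) = chi (a + h *+ n)].

(* Homothets of F with distinct colours, each of which becomes a homothet of f :: F
   when the common focus q is added. *)
Definition focused_in (V : zmodType) (C : eqType) (chi : V -> C) (f : V)
    (F W : seq V) (L r : nat) : Prop :=
  exists (q : V) (s : seq (nat * C)),
    [/\ q \in W, uniq (unzip2 s), size s = r &
      forall n c g, (n, c) \in s -> g \in F ->
        [/\ (0 < n <= L)%N, q + (g - f) *+ n \in W & chi (q + (g - f) *+ n) = c]].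

Lemma homothet_in_cons (V : zmodType) (C : Type) (chi : V -> C) (f q : V)
    (F W : seq V) (L n : nat) :
  (0 < n <= L)%N -> q \in W ->
  (forall g, g \in F -> q + (g - f) *+ n \in W /\ chi (q + (g - f) *+ n) = chi q) ->
  homothet_in chi (f :: F) W L.
Proof.
move=> nL qW qF; exists (q - f *+ n), n.
have E g : q - f *+ n + g *+ n = q + (g - f) *+ n by rewrite mulrnBl addrAC addrA.
have E0 : q - f *+ n + f *+ n = q by rewrite subrK.
have col g : g \in f :: F -> q - f *+ n + g *+ n \in W /\ chi (q - f *+ n + g *+ n) = chi q.
  rewrite inE => /orP[/eqP->|/qF]; first by rewrite E0.
  by rewrite E.
by split=> // [g /col[]//|g h /col[_ ->] /col[_ ->]].
Qed.

(** Induction on the list. For [f :: F], an inner induction on [r] collects [r] homothets of [F] in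
    distinct colours with a common focus; once [r] is the number of colours, the focus shares its
    colour with one of them and completes it. *)
Lemma gallai (V : zmodType) (F : seq V) (C : finType) :
  exists W L, forall chi : V -> C, homothet_in chi F W L.
Proof.
elim: F C => [|f F IHF] C; first by exists [::], 1%N => chi; exists 0, 1%N.
have [->|[g0 g0F]] : F = [::] \/ exists g, g \in F.
    by case: (F) => [|g G]; [left|right; exists g; rewrite mem_head].
  exists [:: f], 1%N => chi; exists 0, 1%N; split=> // [g|g h].
    by rewrite !inE add0r mulr1n.
  by rewrite !inE => /eqP-> /eqP->.
suff focus r : exists W L, forall chi : V -> C,
    homothet_in chi (f :: F) W L \/ focused_in chi f F W L r.
  have [W [L WL]] := focus #|C|; exists W, L => chi.
  have [//|[q [s [qW s_uniq s_size sP]]]] := WL chi.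
  (* Pigeonhole: [s] carries #|C| distinct colours, hence all of them. *)
  have : chi q \in unzip2 s.
    have le_s : (size (enum C) <= size (unzip2 s))%N by rewrite -cardE -s_size size_map.
    by have [_ ->] := uniq_min_size s_uniq (fun x _ => mem_enum C x) le_s; rewrite mem_enum.
  case/mapP=> -[n c] nc /= qc.
  have [nL _ _] := sP _ _ _ nc g0F.
  apply: (homothet_in_cons (q := q) nL qW) => g gF.
  by have [_ ? ->] := sP _ _ _ nc gF.
elim: r => [|r [W [L WL]]].
  by exists [:: 0], 0%N => chi; right; exists 0, [::]; rewrite mem_head.
(* Two points have the same colour in the product colouring when their translates by
   W are coloured alike; the copies of W based at a homothet of F are then alike. *)
have [W' [L' WL']] := IHF {ffun 'I_(size W) -> C}.
(* The shifts by j(f - g0) make room for the new focus, which lies in the copy of [W] based at a +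
   mf = (a + m g0) + m(f - g0), where m <= [L']. *)
pose U := [seq u + w | u <- [seq u + (f - g0) *+ j | u <- W', j <- iota 0 L'.+1], w <- W].
have inU u j w : u \in W' -> (j <= L')%N -> w \in W -> u + (f - g0) *+ j + w \in U.
  by move=> uW' jL' wW; apply: allpairs_f => //; apply: allpairs_f; rewrite // mem_iota.
exists U, (L + L')%N => chi.
have [a [m [/andP[m0 mL'] aW' amono]]] :=
  WL' (fun x => [ffun i : 'I_(size W) => chi (x + nth 0 W i)]).
have amonoW g h w : g \in F -> h \in F -> w \in W ->
    chi (a + g *+ m + w) = chi (a + h *+ m + w).
  move=> gF hF wW; have lt_iW : (index w W < size W)%N by rewrite index_mem.
  have /ffunP/(_ (Ordinal lt_iW)) := amono g h gF hF.
  by rewrite !ffunE /= nth_index.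
have inU' g w : g \in F -> w \in W -> a + g *+ m + w \in U.
  by move=> gF wW; rewrite -[a + _]addr0 -(mulr0n (f - g0)) inU ?aW'.
have shift x y : a + x *+ m = a + y *+ m + (x - y) *+ m.
  by rewrite mulrnBl -addrA (addrC (y *+ m)) subrK.
have [[b [n [/andP[n0 nL] bW bmono]]]|[q [s [qW s_uniq s_size sP]]]] :=
    WL (fun x => chi (a + g0 *+ m + x)).
  left; exists (a + g0 *+ m + b), n; split=> [|g gF|g h gF hF].
  - by rewrite n0 (leq_trans nL) ?leq_addr.
  - by rewrite -addrA inU' ?bW.
  - by rewrite -!(addrA _ b); apply: bmono.
(* If the colour of the old focus already occurs in [s], that homothet is completed; otherwise it is
   a fresh colour for one more homothet. *)
have [/mapP[[n c] nc /= qc]|qNs] := boolP (chi (a + g0 *+ m + q) \in unzip2 s).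
  left; have [/andP[n0 nL] _ _] := sP _ _ _ nc g0F.
  apply: (@homothet_in_cons _ _ _ _ (a + g0 *+ m + q) _ _ _ n); rewrite ?inU' //.
    by rewrite n0 (leq_trans nL) ?leq_addr.
  by move=> g gF; have [_ gW gc] := sP _ _ _ nc gF; rewrite -addrA inU' // qc -gc.
(* The focus moves to the copy of [W] based at a + mf. An old homothet of scale n becomes one of
   scale n + m, its point for g being taken in the copy based at a + mg; the old focus, repeated in
   these copies, yields the new homothet, of scale m. *)
right; exists (q + (a + f *+ m)),
  ((m, chi (a + g0 *+ m + q)) :: [seq (x.1 + m, x.2)%N | x <- s]); split=> /=.
- by rewrite addrC (shift f g0) inU ?aW'.
- by rewrite /unzip2 -map_comp (@eq_map _ _ _ snd) // qNs.
- by rewrite size_map s_size.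
have E n g : q + (a + f *+ m) + (g - f) *+ (n + m) =
    a + g *+ m + (q + (g - f) *+ n).
  by rewrite mulrnDr addrACA [RHS]addrC (shift g f).
move=> n c g; rewrite inE => /orP[/eqP[-> ->] gF|/mapP[[n' c'] nc [-> ->]] gF].
  have := E 0 g; rewrite add0n mulr0n addr0 => ->.
  by rewrite m0 (leq_trans mL') ?leq_addl // inU' // (amonoW g g0).
have [/andP[n0 nL] gW gc] := sP _ _ _ nc gF; rewrite E.
by rewrite addn_gt0 n0 leq_add // inU' // (amonoW g g0).
Qed.

(** * The dot product *)

Definition dot (F : comNzRingType) (d : nat) (u v : 'cV[F]_d) : F :=
  \sum_i u i 0 * v i 0.

Lemma dotC (F : comNzRingType) (d : nat) (u v : 'cV[F]_d) : dot u v = dot v u.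
Proof. by apply: eq_bigr => i _; rewrite mulrC. Qed.

Lemma dotDl (F : comNzRingType) (d : nat) (u v w : 'cV[F]_d) :
  dot (u + v) w = dot u w + dot v w.
Proof. by rewrite -big_split; apply: eq_bigr => i _; rewrite mxE mulrDl. Qed.

Lemma dotZl (F : comNzRingType) (d : nat) (a : F) (u v : 'cV[F]_d) :
  dot (a *: u) v = a * dot u v.
Proof. by rewrite mulr_sumr; apply: eq_bigr => i _; rewrite mxE mulrA. Qed.

Lemma dotDr (F : comNzRingType) (d : nat) (u v w : 'cV[F]_d) :
  dot w (u + v) = dot w u + dot w v.
Proof. by rewrite !(dotC w) dotDl. Qed.

Lemma dotZr (F : comNzRingType) (d : nat) (a : F) (u v : 'cV[F]_d) :
  dot v (a *: u) = a * dot v u.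
Proof. by rewrite !(dotC v) dotZl. Qed.

Lemma dot0l (F : comNzRingType) (d : nat) (u : 'cV[F]_d) : dot 0 u = 0.
Proof. by rewrite -(scale0r 0) dotZl mul0r. Qed.

Lemma dotNl (F : comNzRingType) (d : nat) (u v : 'cV[F]_d) : dot (- u) v = - dot u v.
Proof. by rewrite -scaleN1r dotZl mulN1r. Qed.

Lemma dotNr (F : comNzRingType) (d : nat) (u v : 'cV[F]_d) : dot u (- v) = - dot u v.
Proof. by rewrite dotC dotNl dotC. Qed.

Definition dotE := (dotDl, dotDr, dotNl, dotNr, dotZl, dotZr).

Lemma dot_ge0 (F : realDomainType) (d : nat) (u : 'cV[F]_d) : 0 <= dot u u.
Proof. by apply: sumr_ge0 => i _; rewrite -expr2 sqr_ge0. Qed.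

Lemma entry_sqr_le_dot (F : realDomainType) (d : nat) (u : 'cV[F]_d) i :
  u i 0 ^+ 2 <= dot u u.
Proof.
rewrite /dot (bigD1 i) //= -expr2 lerDl sumr_ge0 // => j _.
by rewrite -expr2 sqr_ge0.
Qed.

Lemma dot_gt0 (F : realDomainType) (d : nat) (u : 'cV[F]_d) :
  (0 < dot u u) = (u != 0).
Proof.
rewrite lt_neqAle dot_ge0 andbT eq_sym; congr negb; apply/eqP/eqP => [u0|->].
  apply/colP => i; rewrite mxE; apply/eqP; rewrite -sqrf_eq0 eq_le sqr_ge0 andbT.
  by rewrite -u0 entry_sqr_le_dot.
by rewrite dot0l.
Qed.

(** * Separation of finitely many points from the origin *)

Lemma convex_setZD (R : realType) (M : lmodType R) (K : set M) (x y : M) (a b : R) :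
  @convex_set R M K -> K x -> K y -> 0 <= a -> 0 <= b -> a + b = 1 ->
  K (a *: x + b *: y).
Proof.
move=> cK Kx Ky a0 b0 ab.
have a1 : a <= 1 by lra.
have -> : b = 1 - a by rewrite -ab addrAC subrr add0r.
have := cK x y (Itv01 a0 a1); rewrite !inE => /(_ Kx Ky).
exact.
Qed.

(* Induction on the list: if v is positive on ys but not on y, project ys along y onto
   the orthogonal complement of v and apply the induction hypothesis again. *)
Lemma strict_separation (R : realType) (d : nat) (ys : seq 'cV[R]_d) :
  (exists v, forall y, y \in ys -> 0 < dot v y) \/
  (forall K : set 'cV[R]_d, @convex_set R 'cV[R]_d K ->
    (forall y, y \in ys -> K y) -> K 0).
Proof.
have [n] := ubnP (size ys); elim: n ys => // n IHn [|y ys] /=; first by left; exists 0.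
rewrite ltnS => lt_ys.
have [->|y_neq0] := eqVneq y 0; first by right => K _; apply; rewrite mem_head.
(* A small tilt of [v] towards [y] gains positivity on [y] and keeps it on the finitely many points
   of [ys]. *)
have orth v : dot v y = 0 -> (forall z, z \in ys -> 0 < dot v z) ->
    exists v', forall z, z \in y :: ys -> 0 < dot v' z.
  move=> vy vys.
  have [e e0 eP] : exists2 e : R, 0 < e & forall z, z \in ys -> 0 < dot (v + e *: y) z.
    elim: (ys) vys => [|z zs IHzs] vzs; first by exists 1.
    have [z' z'zs|e e0 eP] := IHzs; first by apply: vzs; rewrite inE z'zs orbT.
    have vz : 0 < dot v z by apply: vzs; rewrite mem_head.
    have [yz|yz] := leP 0 (dot y z).
      exists e => // z'; rewrite inE => /orP[/eqP->|/eP//].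
      by rewrite !dotE ltr_wpDr // mulr_ge0 // ltW.
    (* The second bound keeps <v, z> + m<y, z> at least <v, z>/2. *)
    pose m := Num.min e (- dot v z / (2 * dot y z)).
    have m0 : 0 < m.
      by rewrite lt_min e0 mulNr -mulrN -invrN divr_gt0 // oppr_gt0; nra.
    exists m => // z'; rewrite inE !dotE => /orP[/eqP->|z'zs].
      have : - dot v z / (2 * dot y z) * dot y z <= m * dot y z.
        by rewrite ler_nM2r // ge_min lexx orbT.
      suff -> : - dot v z / (2 * dot y z) * dot y z = - dot v z / 2 by lra.
      by field; rewrite lt_eqF.
    have := eP _ z'zs; rewrite !dotE.
    have := vzs z'; rewrite inE z'zs orbT => /(_ isT).
    have : m <= e by rewrite ge_min lexx.
    nra.
  exists (v + e *: y) => z; rewrite inE => /orP[/eqP->|/eP//].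
  by rewrite dotDl vy add0r dotZl mulr_gt0 // dot_gt0.
have [[v vys]|K0] := IHn _ lt_ys; last first.
  by right=> K cK Kys; apply: K0 => // z zys; apply: Kys; rewrite inE zys orbT.
have [vy|vy|vy] := ltgtP 0 (dot v y).
- by left; exists v => z; rewrite inE => /orP[/eqP->|/vys].
(* Chosen so that z + t(z)y is orthogonal to [v]. *)
- pose t z := - dot v z / dot v y.
  have t0 z : z \in ys -> 0 < t z.
    by move=> /vys vz; rewrite /t mulNr -mulrN -invrN divr_gt0 // oppr_gt0.
  have [] := IHn [seq z + t z *: y | z <- ys]; first by rewrite size_map.
    (* This [c] makes u + cv orthogonal to [y], and <u + cv, z> equals <u, z + t(z)y>, which is
       positive. *)
    move=> [u uys]; left; pose c := - dot u y / dot v y.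
    have vy0 : dot v y != 0 by rewrite lt_eqF.
    apply: (orth (u + c *: v)) => [|z zys].
      by rewrite dotDl dotZl /c divfK // subrr.
    have := uys _ (map_f _ zys); rewrite !dotE.
    suff -> : c * dot v z = t z * dot u y by [].
    rewrite /c /t; ring.
  move=> K0; right=> K cK Kys.
  (* The projections z + t z *: y lie in K only up to scaling, so use its cone. *)
  pose K' := [set z : 'cV[R]_d | exists2 s : R, 0 < s & K (s *: z)].
  have [||s s0] := K0 K'; last by rewrite scaler0.
    apply/convex_setW; move=> z1 z2; rewrite !inE => -[s1 s10 Kz1] [s2 s20 Kz2] k k0 k1.
    pose a := k%:num / s1; pose b := (1 - k%:num) / s2.
    have a0 : 0 < a by rewrite divr_gt0.
    have b0 : 0 < b by rewrite divr_gt0 // subr_gt0.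
    rewrite inE; exists (a + b)^-1; first by rewrite invr_gt0 addr_gt0.
    have -> : (a + b)^-1 *: (k%:num *: z1 + (1 - k%:num) *: z2 : 'cV[R]_d) =
        (a / (a + b)) *: (s1 *: z1) + (b / (a + b)) *: (s2 *: z2).
      have ka : k%:num = a * s1 by rewrite divfK // gt_eqF.
      have kb : 1 - k%:num = b * s2 by rewrite divfK // gt_eqF.
      by rewrite scalerDr kb ka !scalerA; congr (_ *: _ + _ *: _); ring.
    apply: convex_setZD => //; try by rewrite divr_ge0 // ltW // addr_gt0.
    by rewrite -mulrDl divff // gt_eqF // addr_gt0.
  (* Dividing z + t(z)y by 1 + t(z) gives a convex combination of [z] and [y]. *)
  move=> _ /mapP[z zys ->]; exists (1 + t z)^-1.
    by rewrite invr_gt0 ltr_wpDl ?t0.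
  rewrite scalerDr scalerA.
  apply: convex_setZD => //.
  - by apply: Kys; rewrite inE zys orbT.
  - by apply: Kys; rewrite mem_head.
  - by rewrite invr_ge0 addr_ge0 // ltW ?t0.
  - by rewrite mulr_ge0 ?invr_ge0 ?addr_ge0 // ltW ?t0.
  - have := t0 z zys => tz; field; lra.
- by left; apply: orth vys.
Qed.

(** * Integral multiples of reflections *)

(* |w|^2 times the reflection in the hyperplane orthogonal to w, which is integral
   when w is. *)
Definition scaled_reflection (F : comNzRingType) (d : nat) (w : 'cV[F]_d) : 'M[F]_d :=
  (dot w w)%:M - 2 *: (w *m w^T).

Lemma mulmx_trE (F : comNzRingType) (d : nat) (u v : 'cV[F]_d) :
  u^T *m v = (dot u v)%:M.
Proof.
by apply/matrixP => i j; rewrite !ord1 !mxE eqxx mulr1n; apply: eq_bigr => k _; rewrite !mxE.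
Qed.

Lemma scaled_reflectionE (F : comNzRingType) (d : nat) (w y : 'cV[F]_d) :
  scaled_reflection w *m y = dot w w *: y - (2 * dot w y) *: w.
Proof.
by rewrite mulmxBl mul_scalar_mx -scalemxAl -mulmxA mulmx_trE mul_mx_scalar scalerA.
Qed.

Lemma scaled_reflection_tr (F : comNzRingType) (d : nat) (w : 'cV[F]_d) :
  (scaled_reflection w)^T = scaled_reflection w.
Proof. by rewrite /scaled_reflection linearB linearZ /= tr_scalar_mx trmx_mul trmxK. Qed.

Lemma scaled_reflection_sqr (F : comNzRingType) (d : nat) (w : 'cV[F]_d) :
  scaled_reflection w *m scaled_reflection w = (dot w w ^+ 2)%:M.
Proof.
rewrite {2}/scaled_reflection mulmxBr mul_mx_scalar -scalemxAr mulmxA scaled_reflectionE.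
rewrite -scalerBl -scalemxAl scalerA /scaled_reflection scalerBr scalerA.
rewrite scale_scalar_mx -expr2 -addrA -opprD -scalerDl.
rewrite [X in X *: _](_ : _ = 0) ?scale0r ?subr0 //; ring.
Qed.

Lemma map_scaled_reflection (R : realType) (d : nat) (w : 'cV[int]_d) :
  map_mx intr (scaled_reflection w) = scaled_reflection (intvec R w).
Proof.
rewrite /scaled_reflection map_mxB map_scalar_mx map_mxZ map_mxM map_trmx /=.
congr (_%:M - _); rewrite rmorph_sum; apply: eq_bigr => i _.
by rewrite rmorphM !mxE.
Qed.

Lemma dot_intvec (R : realType) (d : nat) (u v : 'cV[int]_d) :
  dot (intvec R u) (intvec R v) = (dot u v)%:~R.
Proof. by rewrite rmorph_sum; apply: eq_bigr => i _; rewrite rmorphM !mxE. Qed.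

Lemma dot_sup_le (R : realDomainType) (d : nat) (u v : 'cV[R]_d) (A B : R) :
  (forall i, `|u i 0| <= A) -> (forall i, `|v i 0| <= B) ->
  `|dot u v| <= d%:R * (A * B).
Proof.
move=> uA vB; apply: le_trans (ler_norm_sum _ _ _) _.
have -> : d%:R * (A * B) = \sum_(i < d) A * B by rewrite sumr_const card_ord mulr_natl.
apply: ler_sum => i _.
by rewrite normrM ler_pM.
Qed.

Lemma ler_normM2 (R : realDomainType) (a b A B : R) :
  `|a| <= A -> `|b| <= B -> `|a * b| <= A * B.
Proof. by move=> aA bB; rewrite normrM ler_pM. Qed.

(** Controls the error of rounding [w]. The difference expands into four products, bounded by 5, 4,
    4 and 2 times d^2 Y eta; eta <= 1 absorbs the terms quadratic in [e]. *)
Lemma reflection_perturbation (R : realDomainType) (d : nat) (x y w e : 'cV[R]_d)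
    (Y eta : R) :
  (forall i, `|x i 0| <= 1) -> (forall i, `|y i 0| <= Y) ->
  (forall i, `|w i 0| <= 2) -> (forall i, `|e i 0| <= eta) -> 0 <= Y -> 0 <= eta <= 1 ->
  `|dot x (scaled_reflection (w + e) *m y) - dot x (scaled_reflection w *m y)|
    <= 15 * d%:R ^+ 2 * Y * eta.
Proof.
move=> x1 yY w2 e1 Y0 /andP[eta0 eta1].
have c0 : 0 <= d%:R :> R by [].
have xy := dot_sup_le x1 yY; have we := dot_sup_le w2 e1; have ee := dot_sup_le e1 e1.
have wx := dot_sup_le w2 x1; have ey := dot_sup_le e1 yY; have ex := dot_sup_le e1 x1.
have wy := dot_sup_le w2 yY.
have le2 : d%:R * (eta * eta) <= d%:R * eta :> R by rewrite ler_wpM2l // ler_piMr.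
have wee : `|2 * dot w e + dot e e| <= 5 * d%:R * eta.
  apply: le_trans (ler_normD _ _) _; rewrite normrM ger0_norm //; lra.
have h1 := ler_normM2 xy wee.
have h2 := ler_normM2 wx ey.
have h3 := ler_normM2 ex wy.
have h4 := ler_normM2 ex ey.
have le4 : d%:R * (eta * 1) * (d%:R * (eta * Y)) <= d%:R ^+ 2 * Y * eta :> R.
  have := ler_wpM2l (mulr_ge0 c0 Y0) le2; nra.
rewrite !scaled_reflectionE !dotE !(dotC e w) !(dotC x w) !(dotC x e).
rewrite [X in `|X|](_ : _ = dot x y * (2 * dot w e + dot e e) -
  2 * (dot w x * dot e y) - 2 * (dot e x * dot w y) - 2 * (dot e x * dot e y)); last ring.
move: h1 h2 h3 h4; rewrite !ler_norml => /andP[? ?] /andP[? ?] /andP[? ?] /andP[? ?].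
by apply/andP; split; lra.
Qed.

(* For unit vectors, the reflection in a + (-1)^b u maps u to -(-1)^b a. *)
Lemma scaled_reflection_swap (F : comNzRingType) (d : nat) (a u y : 'cV[F]_d) (b : bool) :
  dot a a = 1 -> dot u u = 1 ->
  (-1) ^+ b * dot u (scaled_reflection (a + (-1) ^+ b *: u) *m y) =
    - (2 * (1 + (-1) ^+ b * dot a u) * dot a y).
Proof.
move=> aa uu; rewrite scaled_reflectionE !dotE (dotC u a) aa uu.
by case: b; rewrite ?expr1 ?expr0; ring.
Qed.

(** * Descent towards the origin by reflections in integer vectors *)

Lemma archi_natr (R : realType) (x : R) : exists n : nat, x < n.+1%:R.
Proof.
exists (Num.truncn `|x|); apply: le_lt_trans (ler_norm x) _.
by have /andP[] := truncn_itv (normr_ge0 x).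
Qed.

(** The quantity made negative is |x + By|^2 - |x|^2 for B = (-1)^b [scaled_reflection] w. Let a and
    u be the unit vectors along v and x. The reflection in a + (-1)^b u makes the linear term at
    most a negative multiple of |x|, and this survives rounding to a rational vector whose
    denominator does not depend on x; the quadratic term stays bounded. *)
Lemma reflection_descent (R : realType) (d : nat) (v : 'cV[R]_d) (ys : seq 'cV[R]_d) :
  v != 0 -> (forall y, y \in ys -> 0 < dot v y) ->
  exists N : nat, forall x : 'cV[int]_d, N%:Z < dot x x ->
    exists (w : 'cV[int]_d) (b : bool), forall y, y \in ys ->
      2 * dot (intvec R x) ((-1) ^+ b *: (scaled_reflection (intvec R w) *m y)) +
        dot (intvec R w) (intvec R w) ^+ 2 * dot y y < 0.
Proof.
move=> v0 vys.
pose a := (Num.sqrt (dot v v))^-1 *: v.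
have unit (u : 'cV[R]_d) : u != 0 ->
    dot ((Num.sqrt (dot u u))^-1 *: u) ((Num.sqrt (dot u u))^-1 *: u) = 1.
  move=> u0; rewrite !dotE mulrA -expr2 exprVn sqr_sqrtr ?dot_ge0 // mulVf //.
  by rewrite gt_eqF ?dot_gt0.
have aa : dot a a = 1 by apply: unit.
have entry_le1 (u : 'cV[R]_d) : dot u u = 1 -> forall i, `|u i 0| <= 1.
  move=> uu i; have := entry_sqr_le_dot u i.
  by rewrite uu -(real_normK (num_real _)) expr_le1.
have [delta delta0 adelta] : exists2 delta : R, 0 < delta &
    forall y, y \in ys -> delta <= dot a y.
  have ays y : y \in ys -> 0 < dot a y.
    by move=> yys; rewrite dotZl mulr_gt0 ?vys // invr_gt0 sqrtr_gt0 dot_gt0.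
  elim: (ys) ays => [|y zs IH] azs; first by exists 1.
  have [z zzs|delta delta0 deltaP] := IH; first by apply: azs; rewrite inE zzs orbT.
  exists (Num.min delta (dot a y)); first by rewrite lt_min delta0 azs ?mem_head.
  move=> z; rewrite inE ge_min => /orP[/eqP->|/deltaP ->//].
  by rewrite lexx orbT.
have [Y Y1 yY] : exists2 Y : R, 1 <= Y & forall y, y \in ys -> forall i, `|y i 0| <= Y.
  exists (1 + \sum_(y <- ys) \sum_i `|y i 0|).
    by rewrite lerDl; apply: sumr_ge0 => y _; apply: sumr_ge0.
  move=> y yys i; rewrite (big_rem y) //= (bigD1 i) //=.
  have s1 : 0 <= \sum_(j | j != i) `|y j 0| by apply: sumr_ge0.
  have s2 : 0 <= \sum_(z <- rem y ys) \sum_j `|z j 0|.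
    by apply: sumr_ge0 => z _; apply: sumr_ge0.
  lra.
pose c : R := d%:R.
have c0 : 0 <= c by [].
(* With denominator M = m + 1, the perturbation bound at eta = 1/M is at most [delta], half of the
   gain 2 [delta] of the exact reflection. *)
have [m Mm] := archi_natr (15 * c ^+ 2 * Y / delta).
pose M : R := m.+1%:R.
have M1 : 1 <= M by rewrite ler1n.
(* Squared because it is compared with |x|^2, which is an integer above n and so at least n + 1. It
   ensures that 2 delta |x| exceeds M^2 (9c)^2 (cY^2), the bound on the quadratic term after
   division by M^2. *)
have [n Nn] := archi_natr ((M ^+ 2 * (9 * c) ^+ 2 * (c * Y ^+ 2) / (2 * delta)) ^+ 2).
exists n => x lt_nx.
have x0 : x != 0 by rewrite -dot_gt0 (le_lt_trans _ lt_nx).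
pose X := intvec R x; pose r := Num.sqrt (dot X X).
have X0 : X != 0 by rewrite -dot_gt0 dot_intvec ltr0z dot_gt0.
pose u := r^-1 *: X.
have uu : dot u u = 1 by apply: unit.
have r0 : 0 < r by rewrite sqrtr_gt0 dot_gt0.
have Xu : X = r *: u by rewrite scalerA divff ?scale1r // gt_eqF.
clearbody u a.
(* This sign keeps w' away from 0: |w'|^2 >= 2. *)
pose b := dot a u < 0.
pose w' := a + (-1) ^+ b *: u.
pose w : 'cV[int]_d := \col_i Num.floor (M * w' i 0).
pose e := M^-1 *: intvec R w - w'.
have eM i : `|e i 0| <= M^-1.
  have /andP[f1 f2] := floor_itv (M * w' i 0).
  have -> : e i 0 = M^-1 * ((Num.floor (M * w' i 0))%:~R - M * w' i 0).
    by rewrite !mxE mulrBr mulKf // gt_eqF // (lt_le_trans _ M1).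
  rewrite normrM ger0_norm ?invr_ge0 // ler_piMr ?invr_ge0 //.
  by move: f2; rewrite intrD ler_norml => f2; lra.
have w'2 i : `|w' i 0| <= 2.
  have := entry_le1 _ aa i; have := entry_le1 _ uu i.
  have := ler_normD (a i 0) ((-1) ^+ b * u i 0).
  have -> : w' i 0 = a i 0 + (-1) ^+ b * u i 0 by rewrite !mxE.
  rewrite normrM normr_sign mul1r; lra.
exists w, b => y yys.
(* By the choice of [b], the factor 2(1 + (-1)^b <a, u>) of the swap formula is at least 2. *)
have main : (-1) ^+ b * dot u (scaled_reflection w' *m y) <= - (2 * delta).
  have ay := adelta y yys.
  rewrite scaled_reflection_swap //.
  have : 0 <= (-1) ^+ b * dot a u.
    by rewrite /b; case: ltP => au; rewrite ?expr1 ?expr0 ?mul1r // mulN1r oppr_ge0 ltW.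
  move=> sau; rewrite lerN2 -mulrA ler_pM2l // (le_trans ay) //.
  by rewrite ler_peMl ?lerDl // (le_trans (ltW delta0)).
have wE : intvec R w = M *: (w' + e).
  by rewrite addrC subrK scalerA divff ?scale1r // gt_eqF // (lt_le_trans _ M1).
set g := w' + e in wE.
have Minv : 0 <= M^-1 <= 1.
  by rewrite invr_ge0 invf_le1 ?M1 ?(lt_le_trans _ M1) // andbT (le_trans _ M1).
have pert := reflection_perturbation (entry_le1 _ uu) (yY y yys) w'2 eM (le_trans ler01 Y1) Minv.
have gdelta : (-1) ^+ b * dot u (scaled_reflection g *m y) <= - delta.
  have small : 15 * c ^+ 2 * Y * M^-1 <= delta.
    rewrite ler_pdivrMr ?(lt_le_trans _ M1) //.
    by move: (ltW Mm); rewrite ler_pdivrMr // [delta * _]mulrC.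
  have diff : (-1) ^+ b * (dot u (scaled_reflection g *m y) -
      dot u (scaled_reflection w' *m y)) <= delta.
    apply: le_trans (ler_norm _) _; rewrite normrM normr_sign mul1r.
    exact: le_trans pert small.
  move: (lerD diff main); rewrite mulrBr subrK.
  by rewrite (_ : delta - 2 * delta = - delta) //; ring.
have gg : dot g g <= 9 * c.
  have g3 i : `|g i 0| <= 3.
    have -> : g i 0 = w' i 0 + e i 0 by rewrite /g !mxE.
    apply: le_trans (ler_normD _ _) _; rewrite (_ : 3 = 2 + 1); last by ring.
    by apply: lerD => //; apply: le_trans (eM i) _; case/andP: Minv.
  apply: le_trans (ler_norm _) (le_trans (dot_sup_le g3 g3) _).
  by rewrite -/c (_ : 3 * 3 = 9); [rewrite mulrC|ring].
have yy : dot y y <= c * Y ^+ 2.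
  exact: le_trans (ler_norm _) (dot_sup_le (yY y yys) (yY y yys)).
clearbody g.
have Br : M ^+ 2 * (9 * c) ^+ 2 * (c * Y ^+ 2) / (2 * delta) < r.
  have B0 : 0 <= M ^+ 2 * (9 * c) ^+ 2 * (c * Y ^+ 2) / (2 * delta).
    rewrite divr_ge0 ?(mulr_ge0 _ (ltW delta0)) //.
    by rewrite !mulr_ge0 ?exprn_ge0 ?mulr_ge0 // (le_trans ler01).
  rewrite -ltr_sqr ?nnegrE ?(ltW r0) //.
  rewrite sqr_sqrtr ?dot_ge0 // dot_intvec (lt_le_trans Nn) //.
  by rewrite pmulrn ler_int -addn1 PoszD lezD1.
have -> : dot X ((-1) ^+ b *: (scaled_reflection (intvec R w) *m y)) =
    r * M ^+ 2 * ((-1) ^+ b * dot u (scaled_reflection g *m y)).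
  by rewrite Xu wE !scaled_reflectionE !dotE; ring.
rewrite wE !dotE.
have gg0 := dot_ge0 g; have yy0 := dot_ge0 y.
have M0 : 0 < M by apply: lt_le_trans M1.
have MM0 : 0 < M ^+ 2 by rewrite exprn_gt0.
have ggyy : dot g g ^+ 2 * dot y y <= (9 * c) ^+ 2 * (c * Y ^+ 2).
  by rewrite ler_pM ?exprn_ge0 // lerXn2r // nnegrE (le_trans gg0).
have rM : M ^+ 2 * ((9 * c) ^+ 2 * (c * Y ^+ 2)) < 2 * delta * r.
  by rewrite [2 * delta * r]mulrC mulrA -ltr_pdivrMr ?mulr_gt0.
set A := (-1) ^+ b * _ in gdelta *.
(* Both terms carry a factor M^2, since the scaled reflection is quadratic in w = Mg. *)
have -> : 2 * (r * M ^+ 2 * A) + (M * (M * dot g g)) ^+ 2 * dot y y =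
    M ^+ 2 * (M ^+ 2 * (dot g g ^+ 2 * dot y y) + 2 * A * r) by ring.
rewrite pmulr_rlt0 //.
apply: le_lt_trans (lerD (ler_wpM2l (ltW MM0) ggyy) (_ : _ <= - (2 * delta * r))) _.
  by rewrite -mulNr -mulrN ler_pM2r // ler_pM2l.
by rewrite subr_lt0.
Qed.

(** * From extreme points to integral descent *)

Lemma trmx_scale (F : pzRingType) (m n : nat) (a : F) (A : 'M[F]_(m, n)) :
  (a *: A)^T = a *: A^T.
Proof. by apply/matrixP => i j; rewrite !mxE. Qed.

Lemma dot_scaled_reflection (F : comNzRingType) (d : nat) (w y : 'cV[F]_d) :
  dot (scaled_reflection w *m y) (scaled_reflection w *m y) = dot w w ^+ 2 * dot y y.
Proof. by rewrite scaled_reflectionE !dotE (dotC y w); ring. Qed.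

Lemma fset_neq (K : choiceType) (A : {fset K}) (a : K) :
  (2 <= #|` A|)%N -> exists2 b, b \in A & b != a.
Proof.
rewrite (cardfsD1 a) => A2; have : (0 < #|` (A `\ a)%fset|)%N.
  by case: (a \in A) A2 => // /ltnW.
by rewrite cardfs_gt0 => /fset0Pn[b]; rewrite !inE => /andP[? ?]; exists b.
Qed.

Lemma intvecD (R : realType) (d : nat) (u v : 'cV[int]_d) :
  intvec R (u + v) = intvec R u + intvec R v.
Proof. exact: map_mxD. Qed.

Lemma intvec_inj (R : realType) (d : nat) : injective (@intvec R d).
Proof.
move=> u v /matrixP uv; apply/matrixP => i j.
by have := uv i j; rewrite !mxE => /intr_inj.
Qed.

(** Without such a [v], every convex set containing the differences s - s0 contains 0. Translated by
    [s0], this puts [s0] in every convex set containing the other points of [S], hence in their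
    hull. *)
Lemma extreme_point_separation (R : realType) (d : nat) (S : {fset 'cV[int]_d})
    (s0 : 'cV[int]_d) :
  extreme_point (intvec R @` [set` S]) (intvec R s0) ->
  exists v : 'cV[R]_d, forall s, s \in S -> s != s0 -> 0 < dot v (intvec R (s - s0)).
Proof.
move=> [_ ext]; pose ys := [seq intvec R (s - s0) | s <- S & s != s0].
have [[v vys]|K0] := strict_separation ys.
  by exists v => s sS ss0; apply/vys/map_f; rewrite mem_filter ss0.
exfalso; apply: ext => K [cK subK].
rewrite -[intvec R s0]add0r.
apply: (K0 [set z | K (z + intvec R s0)]) => [|y].
  apply/convex_setW; move=> y z; rewrite !inE /= => Ky Kz k k0 k1.
  rewrite inE /=.
  have := convex_setZD cK Ky Kz (ltW k0) _ (subrKC _ 1).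
  rewrite subr_ge0 !scalerDr addrACA -scalerDl subrKC scale1r => /(_ (ltW k1)).
  exact.
case/mapP => s; rewrite mem_filter => /andP[ss0 sS] ->.
rewrite /= -intvecD subrK; apply: subK; split; first by exists s.
by move=> /intvec_inj /eqP; rewrite (negbTE ss0).
Qed.

(** Take A = (-1)^b [scaled_reflection] w and D = |w|^2. The equation A^T A = D^2 says that A/D is
    orthogonal, so [A] is an integer matrix of a similarity of ratio [D]. *)
Lemma integral_descent (R : realType) (d : nat) (S : {fset 'cV[int]_d})
    (s0 : 'cV[int]_d) :
  (2 <= #|` S|)%N -> extreme_point (intvec R @` [set` S]) (intvec R s0) ->
  exists N : nat, forall x : 'cV[int]_d, N%:Z < dot x x ->
    exists (A : 'M[int]_d) (D : int), [/\ 0 < D, A^T *m A = (D ^+ 2)%:M &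
      forall s, s \in S -> s != s0 ->
        dot (x + A *m (s - s0)) (x + A *m (s - s0)) < dot x x].
Proof.
move=> S2 ext; have [v vS] := extreme_point_separation ext.
have [s1 s1S s1s0] := fset_neq s0 S2.
have v0 : v != 0.
  by apply/eqP => v0; have := vS _ s1S s1s0; rewrite v0 dot0l ltxx.
have [|N NP] := reflection_descent (ys := [seq intvec R (s - s0) | s <- S & s != s0]) v0.
  by move=> _ /mapP[s + ->]; rewrite mem_filter => /andP[ss0 sS]; apply: vS.
exists N => x /NP[w [b wP]].
have {}wP s : s \in S -> s != s0 -> 2 * dot (intvec R x)
    ((-1) ^+ b *: (scaled_reflection (intvec R w) *m intvec R (s - s0))) +
    dot (intvec R w) (intvec R w) ^+ 2 * dot (intvec R (s - s0)) (intvec R (s - s0)) < 0.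
  by move=> sS ss0; apply/wP/map_f; rewrite mem_filter ss0.
exists ((-1) ^+ b *: scaled_reflection w), (dot w w); split.
(* If w = 0, the strict inequality at the second point [s1] would read 0 < 0. *)
- rewrite dot_gt0; apply/eqP => w0; have := wP _ s1S s1s0.
  rewrite w0 scaled_reflectionE.
  have -> : intvec R 0 = 0 :> 'cV[R]_d by apply: map_mx0.
  by rewrite !(dotE, dot0l, expr0n, mul0r, mulr0, subr0, addr0) ltxx.
- have -> : ((-1) ^+ b *: scaled_reflection w)^T = (-1) ^+ b *: scaled_reflection w.
    by rewrite trmx_scale scaled_reflection_tr.
  rewrite -scalemxAl -scalemxAr scalerA -expr2 sqrr_sign scale1r.
  exact: scaled_reflection_sqr.
move=> s sS ss0; have := wP _ sS ss0.
set y := s - s0; set B := (-1) ^+ b *: scaled_reflection w.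
have -> : (-1) ^+ b *: (scaled_reflection (intvec R w) *m intvec R y) = intvec R (B *m y).
  by rewrite /intvec map_mxM map_mxZ rmorphXn rmorphN1 map_scaled_reflection scalemxAl.
have -> : 2 * dot (intvec R x) (intvec R (B *m y)) +
    dot (intvec R w) (intvec R w) ^+ 2 * dot (intvec R y) (intvec R y) =
    (2 * dot x (B *m y) + dot w w ^+ 2 * dot y y)%:~R.
  by rewrite !dot_intvec intrD !intrM.
rewrite ltrz0.
have BB : dot (B *m y) (B *m y) = dot w w ^+ 2 * dot y y.
  by rewrite -scalemxAl dotZl dotZr mulrA -expr2 sqrr_sign mul1r dot_scaled_reflection.
clearbody y B; rewrite !dotDl !dotDr BB (dotC _ x).
by move=> H; rewrite -addrA gtrDl addrA -mulr2n -mulr_natl.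
Qed.

(** * Similar copies in the lattice and the spread of a colour *)

Lemma integral_image_intro (R : realType) (d : nat) (f : 'cV[R]_d -> 'cV[R]_d)
    (h : 'cV[int]_d -> 'cV[int]_d) (A : set 'cV[int]_d) :
  (forall x, f (intvec R x) = intvec R (h x)) -> integral_image f A (h @` A).
Proof.
move=> fh; rewrite /integral_image; apply/seteqP; split => _ [_ [x Ax <-] <-].
  by exists (h x); [exists x|rewrite fh].
by exists (intvec R x); [exists x|rewrite fh].
Qed.

(** The copying map has ratio nD and orthogonal part A/D. *)
Lemma integral_similar_copy (R : realType) (d : nat) (S : set 'cV[int]_d)
    (s0 p : 'cV[int]_d) (A : 'M[int]_d) (D : int) (n : nat) :
  0 < D -> A^T *m A = (D ^+ 2)%:M -> (0 < n)%N ->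
  similar_copy R S s0 [set p + (A *m (s - s0)) *+ n | s in S] p.
Proof.
move=> D0 AA n0; pose Q : 'M[R]_d := D%:~R^-1 *: map_mx intr A.
have Dr0 : (D%:~R : R) != 0 by rewrite intr_eq0 gt_eqF.
pose l : R := n%:R * D%:~R.
pose f z := l *: (Q *m z) + (intvec R p - l *: (Q *m intvec R s0)).
have fE s : f (intvec R s) = intvec R (p + (A *m (s - s0)) *+ n).
  rewrite /f addrCA -scalerBr -mulmxBr intvecD; congr (_ + _).
  rewrite -scalemxAl scalerA /l -mulrA divff // mulr1.
  by rewrite scaler_nat /intvec -map_mxB -map_mxM raddfMn.
exists l, f; split; first split.
- by rewrite mulr_gt0 ?ltr0n // ltr0z.
- exists Q, (intvec R p - l *: (Q *m intvec R s0)); split=> //.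
  rewrite /orthogonal_matrix /Q trmx_scale -scalemxAl -scalemxAr scalerA.
  rewrite map_trmx -map_mxM AA map_scalar_mx scale_scalar_mx /= rmorphXn.
  by rewrite -expr2 -exprMn mulVf // expr1n.
- exact: integral_image_intro.
- by rewrite fE subrr mulmx0 mul0rn addr0.
Qed.

Lemma homothet_similarity (R : realType) (d : nat) (n : nat) (p : 'cV[int]_d) :
  (0 < n)%N ->
  similarity (n%:R : R) (fun z => n%:R *: z + intvec R p).
Proof.
move=> n0; split; first by rewrite ltr0n.
exists 1%:M, (intvec R p); split; first by rewrite /orthogonal_matrix trmx1 mulmx1.
by move=> x; rewrite mul1mx.
Qed.

Lemma dot_ball_finite (d : nat) (N : int) :
  exists F : seq 'cV[int]_d, forall x, dot x x <= N -> x \in F.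
Proof.
pose m := `|N|%N.
(* Integer entries satisfy |x_i| <= x_i^2 <= m, so each is coded by x_i + m among 2m + 1 values. *)
exists [seq map_mx (fun i : 'I_(m + m).+1 => i%:Z - m%:Z) M | M : 'cV_d] => x xN.
apply/mapP; exists (map_mx (fun z : int => inord (absz (z + m%:Z))) x); rewrite ?mem_enum //.
apply/colP => i; rewrite !mxE.
have : x i 0 ^+ 2 <= m%:Z.
  by apply: le_trans (entry_sqr_le_dot x i) (le_trans xN _); rewrite abszE ler_norm.
move: (x i 0) => z zm; rewrite inordK; nia.
Qed.

Lemma monochromatic_spread (R : realType) (d : nat) (S : {fset 'cV[int]_d})
    (s0 : 'cV[int]_d) (C : Type) (chi : 'cV[int]_d -> C) (p : 'cV[int]_d) (n N : nat) (c : C) :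
  (2 <= #|` S|)%N -> (0 < n)%N ->
  (forall x : 'cV[int]_d, N%:Z < dot x x ->
    exists (A : 'M[int]_d) (D : int), [/\ 0 < D, A^T *m A = (D ^+ 2)%:M &
      forall s, s \in S -> s != s0 ->
        dot (x + A *m (s - s0)) (x + A *m (s - s0)) < dot x x]) ->
  ~ (exists T t0, similar_copy R [set` S] s0 T t0 /\ almost_monochromatic chi T t0) ->
  s0 \in S ->
  (forall x, dot x x <= N%:Z -> chi (p + x *+ n) = c) ->
  forall x, chi (p + x *+ n) = c.
Proof.
move=> S2 n0 NP noT s0S ball x; have [m] := ubnP `|dot x x|%N.
elim: m x => // m IHm x; rewrite ltnS => xm.
have [/ball//|/NP[A [D [D0 AA desc]]]] := leP (dot x x) N.
(* Every point of this copy other than its base p + nx has the form p + nz with z closer to the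
   origin, so the induction hypothesis gives it colour [c]. *)
pose T := [set p + x *+ n + (A *m (s - s0)) *+ n | s in [set` S]].
have col s : s \in S -> s != s0 -> chi (p + x *+ n + (A *m (s - s0)) *+ n) = c.
  move=> sS ss0; rewrite -addrA -mulrnDl; apply: IHm.
  have := desc s sS ss0; have := dot_ge0 (x + A *m (s - s0)); have := dot_ge0 x.
  move: (dot _ _) (dot x x) xm => u v; lia.
have Tt0 : T (p + x *+ n) by exists s0 => //; rewrite subrr mulmx0 mul0rn addr0.
have [s sS ss0] := fset_neq s0 S2.
have : monochromatic chi T.
  apply: contrapT => notmono; apply: noT; exists T, (p + x *+ n); split.
    exact: (integral_similar_copy _ _ _ _ D0 AA n0).
  split=> // y z [[sy sy_S <-] yt] [[sz sz_S <-] zt]; rewrite !col //.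
    by apply: contra_notN zt => /eqP ->; rewrite subrr mulmx0 mul0rn addr0.
  by apply: contra_notN yt => /eqP ->; rewrite subrr mulmx0 mul0rn addr0.
(* A point of [T] with s different from [s0] has colour [c] and passes it on to the base. *)
move=> mono; rewrite -(col s sS ss0); apply: mono => //.
by exists s.
Qed.

Lemma extreme_point_gallai (R : realType) (d : nat) (S : {fset 'cV[int]_d})
    (s0 : 'cV[int]_d) (C : finType) :
  (2 <= #|` S|)%N -> extreme_point (intvec R @` [set` S]) (intvec R s0) ->
  exists Lambda : nat, forall chi : 'cV[int]_d -> C,
    (exists (T : set 'cV[int]_d) (t0 : 'cV[int]_d),
      similar_copy R [set` S] s0 T t0 /\ almost_monochromatic chi T t0) \/
    (exists (n : nat) (f : 'cV[R]_d -> 'cV[R]_d) (T : set 'cV[int]_d),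
      [/\ (1 <= n <= Lambda)%N, similarity (n%:R : R) f,
        integral_image f [set: 'cV[int]_d] T & monochromatic chi T]).
Proof.
move=> S2 ext; have [N NP] := integral_descent S2 ext.
have s0S : s0 \in S by case: ext => -[s sS /intvec_inj <-] _.
have [F FP] := dot_ball_finite d N.
have [W [L WL]] := gallai F C; exists L => chi.
have [|noT] := pselect (exists T t0,
  similar_copy R [set` S] s0 T t0 /\ almost_monochromatic chi T t0); first by left.
right; have [p [n [nL _ mono]]] := WL chi; have /andP[n0 _] := nL.
(* The centre 0 of the ball serves as the reference for the common colour. *)
have FN x : dot x x <= N%:Z -> chi (p + x *+ n) = chi (p + 0 *+ n).
  by move=> xN; apply: mono; apply: FP; rewrite ?dot0l.
have all_mono := monochromatic_spread S2 n0 NP noT s0S FN.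
exists n, (fun z => n%:R *: z + intvec R p), [set p + x *+ n | x in [set: 'cV[int]_d]].
split=> //; first exact: homothet_similarity.
  apply: integral_image_intro => x.
  by rewrite addrC intvecD scaler_nat /intvec raddfMn.
by move=> _ _ [x _ <-] [y _ <-]; rewrite !all_mono.
Qed.

Unset Implicit Arguments.

Theorem theorem3p1 (R : realType) (d : nat) (hd : (1 <= d)%N)
    (S : {fset 'cV[int]_d}) (hS : (2 <= #|` S|)%N) (k : nat) :
  exists Lambda : nat,
    forall s0 : 'cV[int]_d,
      extreme_point (intvec R @` [set` S]) (intvec R s0) ->
      forall chi : 'cV[int]_d -> 'I_k,
        (exists (T : set 'cV[int]_d) (t0 : 'cV[int]_d),
            similar_copy R [set` S] s0 T t0 /\ almost_monochromatic chi T t0)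
        \/
        (exists (lambda : nat) (f : 'cV[R]_d -> 'cV[R]_d) (T : set 'cV[int]_d),
            [/\ (1 <= lambda <= Lambda)%N,
                similarity (lambda%:R : R) f,
                integral_image f [set: 'cV[int]_d] T
              & monochromatic chi T]).
Proof.
pose bound s0 L := extreme_point (intvec R @` [set` S]) (intvec R s0) ->
  forall chi : 'cV[int]_d -> 'I_k,
    (exists T t0, similar_copy R [set` S] s0 T t0 /\ almost_monochromatic chi T t0) \/
    (exists (n : nat) (f : 'cV[R]_d -> 'cV[R]_d) (T : set 'cV[int]_d),
      [/\ (1 <= n <= L)%N, similarity (n%:R : R) f,
        integral_image f [set: 'cV[int]_d] T & monochromatic chi T]).
have /choice[L LP] : forall s0, exists L, bound s0 L.
  move=> s0; have [ext|next] := pselect (extreme_point (intvec R @` [set` S]) (intvec R s0)).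
    by have [L LP] := extreme_point_gallai 'I_k hS ext; exists L.
  (* A default value: the bound is vacuous when [s0] is not extreme. *)
  by exists 0%N.
(* [Lambda] is fixed before [s0]; extreme points lie in [S], so a maximum over [S] serves them
   all. *)
exists (\max_(s <- S) L s)%N => s0 ext chi.
have s0S : s0 \in S by case: ext => -[s sS /intvec_inj <-] _.
have [|[n [f [T [/andP[n0 nL] sf If mono]]]]] := LP s0 ext chi; first by left.
right; exists n, f, T; split=> //.
by rewrite n0 (leq_trans nL) // (big_rem s0) //= leq_maxl.
Qed.
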